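(* Let $r\geq 2$ be an integer and let $H$ be an $r$-partite $r$-graph with $h$ vertices and $\ell$ edges. Let $\alpha$ and $A$ be positive reals such that $A\geq r^{2r}$, $\alpha>r-\frac{1}{m_r(H)}$, and $\mathrm{ex}(n,H)\leq An^\alpha$ for all $n$. Then there exist constants $\delta_H, k_0=k_0(H), C=C(H)>0$ such that the following holds. Let $G$ be an $n$-vertex $r$-graph with $kn^\alpha$ edges, where $k\geq k_0$. Then $G$ contains a family $\mathcal{F}$ of copies of $H$ satisfying (1) $|\mathcal{F}|\geq \delta_H[e(G)]^{\frac{h-\alpha}{r-\alpha}}/n^{\frac{\alpha(h-r)}{r-\alpha}}$, and (2) for all $S\subseteq E(G)$ with $1\leq |S|\leq \ell$, $d_{\mathcal{F}}(S)\leq C k^{-\lambda(\alpha,H)(|S|-1)}\frac{|\mathcal{F}|}{e(G)}$, where $\lambda(\alpha,H)=\frac{1}{m_r(H)(r-\alpha)}$.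
   Context: An $r$-graph is an $r$-uniform hypergraph; $\mathrm{ex}(n,H)$ is the maximum number of edges in an $n$-vertex $r$-graph without a copy of $H$. For a family $\mathcal{F}$ of copies of $H$ in $G$ (each viewed as a set of edges) and $S\subseteq E(G)$, $d_{\mathcal{F}}(S)=|\{A\in\mathcal{F}:S\subseteq A\}|$. The $r$-density is $m_r(H)=\max\{\frac{e(F)-1}{v(F)-r}: F\subseteq H,\ v(F)>r\}$. $H$ is assumed to have at least two edges. *)

(* Defs.v *)
From HB Require Import structures.
From mathcomp Require Import all_boot all_order all_algebra.
From mathcomp Require Import reals exp.

Set Implicit Arguments.
Unset Strict Implicit.
Unset Printing Implicit Defensive.

Import Order.TTheory GRing.Theory Num.Theory.

Local Open Scope ring_scope.

(* A hypergraph whose vertex set is the whole finite type V is given by its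
   edge set E : {set {set V}}. *)

Definition r_graph (V : finType) (r : nat) (E : {set {set V}}) : bool :=
  [forall e in E, #|e| == r].

Definition r_partite (V : finType) (r : nat) (E : {set {set V}}) : Prop :=
  exists part : V -> 'I_r,
    forall e, e \in E -> forall i : 'I_r, #|[set x in e | part x == i]| = 1%N.

(* Here a sub-hypergraph is a pair (vertex set, edge set), so that it may have
   isolated vertices. *)
Definition subgraph_type (V : finType) : finType :=
  ({set V} * {set {set V}})%type.

Definition subgraphs (V : finType) (E : {set {set V}}) :
    {set subgraph_type V} :=
  [set F : subgraph_type V |
    (F.2 \subset E) && [forall e in F.2, e \subset F.1]].

(* A copy keeps track of its vertex set: if H has isolated vertices, distinct
   copies may have the same edges; otherwise the edges determine the copy. *)
Definition copies (VH V : finType) (H : {set {set VH}}) (G : {set {set V}}) :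
    {set subgraph_type V} :=
  [set F in subgraphs G | [exists f : {ffun VH -> V},
    [&& injectiveb f,
        F.1 == [set f x | x in [set: VH]] &
        F.2 == [set [set f x | x in (e : {set VH})] | e in H]]]].

Definition ex (VH : finType) (r n : nat) (H : {set {set VH}}) : nat :=
  \max_(G : {set {set 'I_n}} | r_graph r G && (copies H G == set0)) #|G|.

Definition degree (V : finType) (F : {set subgraph_type V})
    (S : {set {set V}}) : nat :=
  #|[set A in F | S \subset A.2]|.

Definition density_ratio (R : realType) (V : finType) (r : nat)
    (F : subgraph_type V) : R :=
  (#|F.2|%:R - 1) / (#|F.1|%:R - r%:R).

(* The fold starts from the ratio of H itself, which is one of the candidates
   as soon as H has more than r vertices (in particular when an r-graph H has
   two edges). *)
Definition r_density (R : realType) (V : finType) (r : nat)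
    (H : {set {set V}}) : R :=
  \big[Num.max/density_ratio R r ([set: V], H)]_(F in subgraphs H |
    (r < #|F.1|)%N) density_ratio R r F.

Definition lambda (R : realType) (V : finType) (r : nat) (alpha : R)
    (H : {set {set V}}) : R :=
  1 / (r_density R r H * (r%:R - alpha)).

(* Main.v *)
(* Put d = r - alpha and let T be the number of copies required in (1).  Take a
   largest family F satisfying the degree bounds of (2) with |F| replaced by T,
   and suppose |F| < T.  Average over the vertex subsets U of size
   m ~ (M / k)^(1/d) n: there G[U] has on average at least twice
   A m^alpha >= ex(m, H) edges.  A set W with |W| >= r lies in U with at most
   (m/n)^(|W| - r) times the probability of an edge, and any nonempty S in a
   copy of H satisfies |S| - 1 <= m_r(H) (v(S) - r); hence the members of F and
   the edge sets S whose degree bound is already tight are rare enough that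
   deleting one edge for each of those inside U leaves, for some U, more than
   ex(m, H) edges.  The resulting new copy can be added to F, contradicting
   maximality. *)

Require Import Defs.
From HB Require Import structures.
From mathcomp Require Import all_boot all_order all_algebra.
From mathcomp Require Import reals exp.
From mathcomp Require Import zify ring lra.

Set Implicit Arguments.
Unset Strict Implicit.
Unset Printing Implicit Defensive.

Import Order.TTheory GRing.Theory Num.Theory.

Local Open Scope ring_scope.

(** * Inclusion probabilities of a random [m]-subset *)

(** Each vertex required beyond the first [r] costs a factor [(m - a) / (n - a)], which is at most
    [m / n] because [m <= n]. *)
Lemma bin_sub_le (n m r v : nat) : (r <= v <= m)%N -> (m <= n)%N ->
  ('C(n - v, m - v) * n ^ (v - r) <= 'C(n - r, m - r) * m ^ (v - r))%N.
Proof.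
move=> /andP[rv vm] mn; move: vm; rewrite -(subnKC rv) addKn.
elim: (v - r)%N => [|d IH] vm; first by rewrite addn0 !expn0.
have {}IH := IH (ltac:(lia)).
rewrite !expnSr !mulnA.
apply: (@leq_trans ('C(n - (r + d), m - (r + d)) * n ^ d * m)%N); last first.
  by rewrite leq_mul2r IH orbT.
set a := (r + d)%N in vm IH *.
have step := mul_bin_diag (n - a) (m - a).-1.
have ->: (n - (r + d.+1) = (n - a).-1)%N by lia.
have ->: (m - (r + d.+1) = (m - a).-1)%N by lia.
have ma: ((m - a).-1.+1 = m - a)%N by lia.
rewrite ma in step.
rewrite mulnAC [leqRHS]mulnAC leq_mul2r; apply/orP; right.
have na : (0 < n - a)%N by lia.
rewrite -(leq_pmul2l na) mulnA step.
have : ((m - a) * n <= (n - a) * m)%N by nia.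
by move: ('C(n - a, m - a)) => c; nia.
Qed.

(** A random [m]-set contains a given [r]-set with probability at least [(m / (r n))^r]: each factor
    [(m - i) / (n - i)] with [i < r] is at least [m / (r n)], since [m <= r (m - i)]. *)
Lemma bin_le_sub (n m r : nat) : (r <= m <= n)%N ->
  ('C(n, m) * m ^ r <= r ^ r * n ^ r * 'C(n - r, m - r))%N.
Proof.
move=> /andP[rm mn].
suff gen i : (i <= r)%N ->
    ('C(n, m) * m ^ i <= r ^ i * n ^ i * 'C(n - i, m - i))%N by exact: gen.
elim: i => [|i IH] ir; first by rewrite !expn0 !mul1n muln1 !subn0.
have {}IH := IH (ltac:(lia)).
rewrite !expnSr mulnA.
apply: (@leq_trans (r ^ i * n ^ i * 'C(n - i, m - i) * m)).
  by rewrite leq_mul2r IH orbT.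
have step := mul_bin_diag (n - i) (m - i).-1.
have ma: ((m - i).-1.+1 = m - i)%N by lia.
rewrite ma in step.
have ->: (n - i.+1 = (n - i).-1)%N by lia.
have ->: (m - i.+1 = (m - i).-1)%N by lia.
have mi : (0 < m - i)%N by lia.
rewrite -mulnA [leqRHS](_ : _ =
    r ^ i * n ^ i * ((r * n) * 'C((n - i).-1, (m - i).-1)))%N; last first.
  by rewrite mulnACA -mulnA.
rewrite leq_mul2l; apply/orP; right.
rewrite -(leq_pmul2l mi) mulnA -step.
have : ((n - i) * m <= (m - i) * (r * n))%N.
  have : (m <= r * (m - i))%N by nia.
  nia.
by move: ('C((n - i).-1, (m - i).-1)) => c; nia.
Qed.

Definition supersets (V : finType) (m : nat) (W : {set V}) : {set {set V}} :=
  [set U : {set V} | (W \subset U) && (#|U| == m)].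

(** The case split matters: for [m < #|W|] the truncated [m - #|W|] would turn the binomial into
    1. *)
Lemma card_supersets (V : finType) (m : nat) (W : {set V}) :
  #|supersets m W| =
    if (#|W| <= m)%N then 'C(#|V| - #|W|, m - #|W|) else 0%N.
Proof.
case: ifPn => [leWm|]; last first.
  rewrite -ltnNge => ltmW; apply: eq_card0 => U; rewrite !inE.
  by apply/negP => /andP[/subset_leq_card WU /eqP Um]; move: WU; rewrite Um leqNgt ltmW.
have -> : (#|V| - #|W|)%N = #|~: W| by rewrite -(cardsC W) addKn.
rewrite -cards_draws; apply/esym.
rewrite -(@card_in_imset _ _ (fun A => A :|: W)); last first.
  move=> A B; rewrite !inE => /andP[AW _] /andP[BW _] eqAB.
  have cancel (X : {set V}) : X \subset ~: W -> (X :|: W) :\: W = X.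
    by rewrite setDUl setDv setU0 setDE => /setIidPl.
  by rewrite -(cancel A AW) eqAB cancel.
apply: eq_card => U; rewrite [in RHS]inE; apply/imsetP/andP => [[A]|[WU /eqP Um]].
  rewrite !inE => /andP[AW /eqP cA] ->; split; first exact: subsetUr.
  by rewrite cardsU disjoint_setI0 ?disjoints_subset // cards0 subn0 cA subnK.
exists (U :\: W); last first.
  by rewrite setUC -[in LHS](setID U W) setUC (setIidPr WU) setUC.
by rewrite inE setDE subsetIr -setDE cardsD (setIidPr WU) Um eqxx.
Qed.

(** * Copies and their transport along injections *)

Lemma copiesP (VH V : finType) (H : {set {set VH}}) (G : {set {set V}})
    (K : subgraph_type V) :
  reflect (exists f : VH -> V,
    [/\ injective f, {in H, forall e : {set VH}, f @: e \in G}
      & K = (f @: [set: VH], [set f @: (e : {set VH}) | e in H])])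
    (K \in copies H G).
Proof.
apply: (iffP idP) => [|[f [injf fG ->]]].
  rewrite !inE => /andP[/andP[/subsetP KG _] /existsP[f /and3P[/injectiveP injf]]].
  move=> /eqP K1 /eqP K2; exists f; split=> // [e eH|]; last first.
    by case: K K1 K2 {KG} => K1 K2 /= -> ->.
  by apply: KG; rewrite K2 imset_f.
rewrite !inE /= -andbA; apply/and3P; split.
- by apply/subsetP => _ /imsetP[e eH ->]; apply: fG.
- by apply/forall_inP => _ /imsetP[e eH ->]; apply: imsetS; apply: subsetT.
apply/existsP; exists [ffun x => f x]; apply/and3P; split.
- by apply/injectiveP => x y; rewrite !ffunE => /injf.
- by apply/eqP/eq_imset => x; rewrite ffunE.
- apply/eqP/eq_imset => e; apply: eq_imset => x; by rewrite ffunE.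
Qed.

Lemma copies_mono (VH V : finType) (H : {set {set VH}}) (E G : {set {set V}}) :
  E \subset G -> copies H E \subset copies H G.
Proof.
move=> /subsetP EG; apply/subsetP => K /copiesP[f [injf fE defK]].
by apply/copiesP; exists f; split=> // e /fE /EG.
Qed.

Lemma copy_edges_sub (VH V : finType) (H : {set {set VH}})
    (G : {set {set V}}) (K : subgraph_type V) :
  K \in copies H G -> (K.2 \subset G) * {in K.2, forall e : {set V}, e \subset K.1}.
Proof.
rewrite !inE => /andP[/andP[KG /forall_inP sK] _].
by split.
Qed.

Lemma card_copy (VH V : finType) (H : {set {set VH}})
    (G : {set {set V}}) (K : subgraph_type V) :
  K \in copies H G -> (#|K.1| = #|VH|) * (#|K.2| = #|H|).
Proof.
move=> /copiesP[f [injf _ ->]] /=; split; first by rewrite card_imset ?cardsT.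
by rewrite card_imset //; apply: imset_inj.
Qed.

(** Since [ex] ranges over graphs on ['I_m], the edges are pulled back along an enumeration [g] of
    [U]. A copy found there is pushed forward by [g], so its vertices lie in [U]. *)
Lemma ex_lt_copy (VH V : finType) (H : {set {set VH}}) (r m : nat)
    (U : {set V}) (E : {set {set V}}) :
  r_graph r E -> #|U| = m -> {in E, forall e : {set V}, e \subset U} ->
  (ex r m H < #|E|)%N ->
  exists2 K, K \in copies H E & K.1 \subset U.
Proof.
move=> /forall_inP Er cU EU exE.
pose g (i : 'I_m) : V := enum_val (cast_ord (esym cU) i).
have injg : injective g by move=> i j /enum_val_inj /cast_ord_inj.
have gU i : g i \in U by apply: enum_valP.
have gimU (e : {set V}) : e \subset U -> g @: (g @^-1: e) = e.
  move=> eU; apply/setP => x; apply/imsetP/idP => [[i] | xe].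
    by rewrite inE => ? ->.
  have xU := subsetP eU x xe.
  exists (cast_ord cU (enum_rank_in xU x)).
    by rewrite inE /g cast_ordK enum_rankK_in.
  by rewrite /g cast_ordK enum_rankK_in.
pose E' := [set g @^-1: (e : {set V}) | e in E].
have cE' : #|E'| = #|E|.
  apply: card_in_imset => e1 e2 /EU s1 /EU s2 eq12.
  by rewrite -(gimU _ s1) eq12 gimU.
have gE' X : X \in E' -> g @: X \in E.
  by case/imsetP => e eE ->; rewrite gimU ?EU.
have rE' : r_graph r E'.
  by apply/forall_inP => X /gE' /Er; rewrite card_imset.
have [noC|] := eqVneq (copies H E') set0.
  have leE' : (#|E'| <= ex r m H)%N.
    by apply: leq_bigmax_cond; rewrite rE' noC eqxx.
  by move: (leq_ltn_trans leE' exE); rewrite cE' ltnn.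
case/set0Pn => K' /copiesP[f [injf fE' _]].
exists ((g \o f) @: [set: VH], [set (g \o f) @: (e : {set VH}) | e in H]).
  apply/copiesP; exists (g \o f); split=> //; first exact: inj_comp.
  by move=> e eH; rewrite imset_comp; apply: gE' (fE' e eH).
by apply/subsetP => _ /imsetP[x _ ->]; apply: gU.
Qed.

(** * Averaging over [m]-sets and deleting edges *)

(** The inequality, divided by the number of [m]-sets, compares expectations: some [U] spans more
    than [ex r m H] edges beyond one for each member of [B] lying in it. Pairs in [B] let earlier
    copies and saturated edge sets be forbidden alike. *)
Lemma exists_copy_avoiding (VH V : finType) (H : {set {set VH}})
    (G : {set {set V}}) (r m : nat) (B : {set subgraph_type V}) :
  r_graph r G ->
  {in B, forall b : subgraph_type V, b.2 != set0} ->
  ('C(#|V|, m) * ex r m H + \sum_(b in B) #|supersets m b.1|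
     < \sum_(e in G) #|supersets m e|)%N ->
  exists2 K, K \in copies H G
    & {in B, forall b : subgraph_type V, ~~ ((b.1 \subset K.1) && (b.2 \subset K.2))}.
Proof.
move=> Gr B0 ineq.
pose inside (U : {set V}) := [set e in G | e \subset U].
pose blocked (U : {set V}) := [set b in B | b.1 \subset U].
have swap (I : finType) (D : {set I}) (W : I -> {set V}) :
    (\sum_(i in D) #|supersets m (W i)| =
     \sum_(U : {set V} | #|U| == m) #|[set i in D | W i \subset U]|)%N.
  transitivity (\sum_(i in D) \sum_(U : {set V} | #|U| == m) (W i \subset U))%N.
    apply: eq_bigr => i _; rewrite -big_mkcondr sum1_card.
    by apply: eq_card => U; rewrite !inE unfold_in andbC.
  rewrite exchange_big; apply: eq_bigr => U _.
  rewrite -big_mkcondr sum1_card.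
  by apply: eq_card => i; rewrite !inE.
have [U /eqP cU ltU] : exists2 U : {set V}, #|U| == m &
    (ex r m H + #|blocked U| < #|inside U|)%N.
  apply/exists_inP; apply: contraTT ineq => /exists_inPn nU.
  rewrite -leqNgt (swap _ G id) (swap _ B fst).
  have -> : 'C(#|V|, m) = (\sum_(U : {set V} | #|U| == m) 1)%N.
    rewrite sum1_card -card_draws; apply: eq_card => U; by rewrite inE.
  rewrite big_distrl -big_split leq_sum //= => U /nU.
  by rewrite -leqNgt mul1n.
(* One edge to delete for each [b]; the default [set0] is never taken on [B], where [b.2] is
   nonempty. *)
pose e0 (b : subgraph_type V) := odflt set0 [pick e in b.2].
pose E := inside U :\: e0 @: blocked U.
have EG : E \subset inside U by apply: subsetDl.
have sub_inside e : e \in E -> e \in G /\ e \subset U.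
  by move=> /(subsetP EG); rewrite inE => /andP.
have [] := @ex_lt_copy VH V H r m U E.
- by apply/forall_inP => e /sub_inside[eG _]; apply: (forall_inP Gr).
- by [].
- by move=> e /sub_inside[].
- rewrite cardsD ltn_subRL addnC (leq_ltn_trans _ ltU) // leq_add2l.
  exact: leq_trans (subset_leq_card (subsetIr _ _)) (leq_imset_card _ _).
move=> K KE KU; exists K.
  by apply: (subsetP (copies_mono H _) K KE); apply/subsetP => e /sub_inside[].
move=> b bB; apply/negP => /andP[b1 b2].
(* If [b] were inside [K], then [b.1] would lie in [U], so [e0 b] was deleted and cannot be an edge
   of [K]. *)
have e0b : e0 b \in b.2.
  rewrite /e0; case: pickP => //= none; case/set0Pn: (B0 b bB) => e eb.
  by move: (none e); rewrite eb.
have := subsetP (copy_edges_sub KE).1 _ (subsetP b2 _ e0b).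
rewrite inE => /andP[/negP[]]; apply: imset_f.
by rewrite inE bB (subset_trans b1 KU).
Qed.

(** * Density bounds for edge sets inside a copy *)

Lemma imset_cover (VH V : finType) (f : VH -> V) (S : {set {set VH}}) :
  cover [set f @: (e : {set VH}) | e in S] = f @: cover S.
Proof.
apply/setP => y; apply/bigcupP/imsetP.
  case=> _ /imsetP[e eS ->] /imsetP[x xe ->]; exists x => //.
  by apply/bigcupP; exists e.
case=> x /bigcupP[e eS xe] ->; exists (f @: e); first exact: imset_f.
exact: imset_f.
Qed.

Lemma card_cover_ge (V : finType) (r : nat) (S : {set {set V}}) :
  r_graph r S -> S != set0 -> (r <= #|cover S|)%N.
Proof.
move=> /forall_inP Sr /set0Pn[e eS]; rewrite -(eqP (Sr e eS)).
exact/subset_leq_card/bigcup_sup.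
Qed.

Lemma r_graph_sub (V : finType) (r : nat) (E G : {set {set V}}) :
  E \subset G -> r_graph r G -> r_graph r E.
Proof.
by move=> /subsetP EG /forall_inP Gr; apply/forall_inP => e /EG /Gr.
Qed.

Lemma r_density_ge (R : realType) (V : finType) (r : nat) (H : {set {set V}})
    (F : subgraph_type V) :
  F \in subgraphs H -> (r < #|F.1|)%N ->
  density_ratio R r F <= r_density R r H.
Proof.
move=> FH rF; rewrite /r_density (bigD1 F) ?FH //=.
by rewrite le_max lexx.
Qed.

(** If the cover has more than [r] vertices, [(cover S, S)] is a candidate in the maximum. If it has
    exactly [r], that ratio is excluded, but every edge equals the cover, so [S] has at most one
    edge and the left side is not positive. *)
Lemma edges_le_density (R : realType) (V : finType) (r : nat)
    (H S : {set {set V}}) :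
  r_graph r H -> S \subset H -> S != set0 ->
  #|S|%:R - 1 <= r_density R r H * (#|cover S|%:R - r%:R).
Proof.
move=> Hr SH S0; have Sr := r_graph_sub SH Hr.
have := card_cover_ge Sr S0; rewrite leq_eqVlt => /predU1P[rE|ltr].
  rewrite -rE subrr mulr0 subr_le0 (ler_nat _ _ 1%N).
  rewrite -(cards1 (cover S)); apply/subset_leq_card/subsetP => e eS.
  rewrite inE eqEcard -rE (eqP (forall_inP Sr e eS)) leqnn andbT.
  exact: bigcup_sup.
rewrite -ler_pdivrMr ?subr_gt0 ?ltr_nat //.
apply: (@r_density_ge R V r H (cover S, S)) => //.
by rewrite inE SH; apply/forall_inP => e eS; apply: bigcup_sup.
Qed.

Lemma copy_edges_le_density (R : realType) (VH V : finType) (r : nat)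
    (H : {set {set VH}}) (G S : {set {set V}}) (K : subgraph_type V) :
  r_graph r H -> K \in copies H G -> S \subset K.2 -> S != set0 ->
  #|S|%:R - 1 <= r_density R r H * (#|cover S|%:R - r%:R).
Proof.
move=> Hr /copiesP[f [injf _ ->]] /= SK S0.
pose S' := [set e in H | f @: e \in S].
have defS : S = [set f @: (e : {set VH}) | e in S'].
  apply/setP => y; apply/idP/imsetP => [yS|[e]]; last by rewrite inE => /andP[_ ?] ->.
  by have /imsetP[e eH ye] := subsetP SK y yS; exists e; rewrite // inE eH -ye.
have inj_im : injective (fun e : {set VH} => f @: e) by exact: imset_inj.
rewrite defS imset_cover !card_imset //; apply: edges_le_density => //.
  by apply/subsetP => e; rewrite inE => /andP[].
by apply: contraNneq S0 => S'0; rewrite defS S'0 imset0.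
Qed.

(** * A largest family with bounded degrees *)

Lemma card_supersets_le (V : finType) (m r : nat) (W : {set V}) :
  (r <= #|W|)%N -> (m <= #|V|)%N ->
  (#|supersets m W| * #|V| ^ (#|W| - r)
     <= 'C(#|V| - r, m - r) * m ^ (#|W| - r))%N.
Proof.
by move=> rW mV; rewrite card_supersets; case: ifP => // Wm; rewrite bin_sub_le ?rW.
Qed.

Lemma sum_setU_le (I : finType) (A B : {set I}) (f : I -> nat) :
  (\sum_(i in A :|: B) f i <= \sum_(i in A) f i + \sum_(i in B) f i)%N.
Proof.
rewrite big_mkcond [X in (_ <= X + _)%N]big_mkcond [X in (_ <= _ + X)%N]big_mkcond.
rewrite -big_split leq_sum //= => i _; rewrite inE.
by case: (i \in A) => /=; [exact: leq_addr | exact: leq_addl].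
Qed.

(** Double counting of pairs [S \subset K.2]: each copy has [2 ^ #|H|] sets of edges. *)
Lemma sum_degree_le (VH V : finType) (H : {set {set VH}}) (G : {set {set V}})
    (F : {set subgraph_type V}) (Q : {set {set {set V}}}) :
  F \subset copies H G ->
  (\sum_(S in Q) degree F S <= #|F| * 2 ^ #|H|)%N.
Proof.
move=> /subsetP FH.
under eq_bigr => S _.
  rewrite /degree -sum1_card (eq_bigl (fun A => (A \in F) && (S \subset A.2))); last first.
    by move=> A; rewrite inE.
  rewrite big_mkcondr; over.
rewrite exchange_big /= -sum_nat_const leq_sum // => K /FH /card_copy[_ <-].
rewrite -card_powerset -sum1_card [leqRHS]big_mkcond [leqLHS]big_mkcond /=.
by rewrite leq_sum // => S _; rewrite powersetE; case: (S \in Q); case: (S \subset _).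
Qed.

(** [N * #|G|] is the sum of the edge counts of [G[U]] over all [m]-sets [U]. While [#|F| < T], the
    saturated sets and the members of [F] each use at most a quarter of it, and the extremal number
    less than half. *)
Lemma balanced_family (R : realType) (VH V : finType) (H : {set {set VH}})
    (G : {set {set V}}) (r m : nat) (Delta : nat -> R) (T : R) :
  let N : R := 'C(#|V| - r, m - r)%:R in
  r_graph r G -> (r <= m)%N -> H != set0 -> 0 < T ->
  (forall j, (1 <= j <= #|H|)%N -> 2 <= Delta j) ->
  {in copies H G, forall K : subgraph_type V, forall S : {set {set V}},
    S \subset K.2 -> S != set0 ->
    #|supersets m (cover S)|%:R * (2 ^ (#|H| + 3))%:R * T
      <= N * #|G|%:R * Delta #|S|} ->
  {in copies H G, forall K : subgraph_type V,
    #|supersets m K.1|%:R * 4 * T <= N * #|G|%:R} ->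
  2 * ('C(#|V|, m) * ex r m H)%:R < N * #|G|%:R ->
  exists F : {set subgraph_type V},
    [/\ F \subset copies H G, T <= #|F|%:R
      & forall S : {set {set V}}, S \subset G -> (1 <= #|S| <= #|H|)%N ->
          (degree F S)%:R <= Delta #|S|].
Proof.
move=> N Gr rm H0 T0 Delta2 supS supK exN.
pose balanced (F : {set subgraph_type V}) := (F \subset copies H G) &&
  [forall S : {set {set V}}, (S \subset G) ==> (1 <= #|S| <= #|H|)%N ==>
     ((degree F S)%:R <= Delta #|S|)].
have degree0 S : degree (set0 : {set subgraph_type V}) S = 0%N.
  by apply: eq_card0 => A; rewrite !inE.
have bal0 : balanced set0.
  rewrite /balanced sub0set; apply/forallP => S; apply/implyP => _; apply/implyP => Sl.
  by rewrite degree0 (le_trans _ (Delta2 _ Sl)) // ler0n.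
case: (arg_maxnP (fun F : {set subgraph_type V} => #|F|) bal0) => F balF maxF.
have /andP[FH /forallP degF] := balF.
exists F; split=> //; last first.
  by move=> S SG Sl; move/implyP: (degF S) => /(_ SG) /implyP /(_ Sl).
rewrite leNgt; apply/negP => FT.
(* The saturated sets: one more copy through [S] would break its bound. As [Delta >= 2], such an [S]
   has positive degree, hence lies in a copy, and its degree is at least [Delta / 2]. *)
pose Q := [set S : {set {set V}} |
  [&& S \subset G, (1 <= #|S| <= #|H|)%N & Delta #|S| < (degree F S).+1%:R]].
have Qdeg S : S \in Q -> Delta #|S| <= 2 * (degree F S)%:R.
  rewrite inE => /and3P[_ /Delta2 D2]; rewrite -natr1 => ltD.
  have : (0 : R) < (degree F S)%:R by lra.
  rewrite ltr0n -(ler1n R); lra.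
have Qcopy S : S \in Q -> exists2 K, K \in copies H G & S \subset K.2.
  move=> SQ; have : (0 < degree F S)%N.
    move: (Qdeg S SQ); move: SQ; rewrite inE => /and3P[_ /Delta2 D2 _] dS.
    by rewrite -(ltr0n R); lra.
  by case/card_gt0P => K; rewrite inE => /andP[/(subsetP FH) KH SK]; exists K.
have Q0 S : S \in Q -> S != set0.
  by rewrite inE -card_gt0 => /and3P[_ /andP[]].
pose B := F :|: [set ((cover S, S) : subgraph_type V) | S in Q].
have sumQ : (\sum_(S in Q) #|supersets m (cover S)|)%:R * 4 * T
    <= N * #|G|%:R * #|F|%:R.
  (* The exponent [#|H| + 3] absorbs the [2 ^ #|H|] edge subsets per copy, the factor 2 from [Qdeg],
     and the 4 of the quarter. *)
  have : (\sum_(S in Q) #|supersets m (cover S)|)%:R * (2 ^ (#|H| + 3))%:R * T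
      <= N * #|G|%:R * (2 * (#|F| * 2 ^ #|H|)%:R).
    rewrite natr_sum !mulr_suml.
    apply: (@le_trans _ _ (\sum_(S in Q) N * #|G|%:R * (2 * (degree F S)%:R))).
      apply: ler_sum => S SQ; have [K KH SK] := Qcopy S SQ.
      apply: le_trans (supS K KH S SK (Q0 S SQ)) _.
      by rewrite ler_wpM2l ?Qdeg // mulr_ge0.
    rewrite -!mulr_sumr ler_wpM2l ?mulr_ge0 // ler_wpM2l // -natr_sum ler_nat.
    exact: sum_degree_le FH.
  have p0 : (0 : R) < (2 ^ #|H|)%:R by rewrite ltr0n expn_gt0.
  have p8 : (2 ^ (#|H| + 3))%:R = (2 ^ #|H|)%:R * 8 :> R by rewrite expnD natrM.
  rewrite p8 natrM; move: p0; move: (2 ^ #|H|)%:R (\sum_(S in Q) _)%:R => p s p0 ineq.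
  rewrite -(ler_pM2r (mulr_gt0 (ltr0n R 2) p0)).
  have -> : s * 4 * T * (2 * p) = s * (p * 8) * T by ring.
  by have -> : N * #|G|%:R * #|F|%:R * (2 * p) = N * #|G|%:R * (2 * (#|F|%:R * p)) by ring.
have sumF : (\sum_(K in F) #|supersets m K.1|)%:R * 4 * T <= N * #|G|%:R * #|F|%:R.
  rewrite natr_sum !mulr_suml.
  rewrite [leRHS]mulr_natr -sumr_const; apply: ler_sum => K /(subsetP FH).
  exact: supK.
have sumB : (\sum_(b in B) #|supersets m b.1| <=
    \sum_(K in F) #|supersets m K.1| + \sum_(S in Q) #|supersets m (cover S)|)%N.
  apply: leq_trans (sum_setU_le _ _ _) _; rewrite leq_add2l.
  by rewrite big_imset // => S1 S2 _ _ [].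
have Ne0 : 0 < N * #|G|%:R by apply: le_lt_trans exN; rewrite mulr_ge0.
have [||K KH avoidK] := @exists_copy_avoiding VH V H G r m B Gr.
- move=> b; rewrite inE => /orP[/(subsetP FH) /card_copy[_ cb]|/imsetP[S /Q0 ? ->]] //.
  by rewrite -card_gt0 cb card_gt0.
- rewrite -(ltr_nat R).
  have -> : (\sum_(e in G) #|supersets m e|)%:R = N * #|G|%:R.
    rewrite mulrC /N -natrM -sum_nat_const; congr _%:R; apply: eq_bigr => e eG.
    by rewrite card_supersets (eqP (forall_inP Gr e eG)) rm.
  set sQ := (\sum_(S in Q) _)%N in sumQ sumB.
  set sF := (\sum_(K in F) _)%N in sumF sumB.
  have NeT : N * #|G|%:R * #|F|%:R <= N * #|G|%:R * T.
    by rewrite ler_wpM2l ?(ltW Ne0) // ltW.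
  have sQ4 : sQ%:R * 4 <= N * #|G|%:R by rewrite -(ler_pM2r T0) (le_trans sumQ).
  have sF4 : sF%:R * 4 <= N * #|G|%:R by rewrite -(ler_pM2r T0) (le_trans sumF).
  move: sumB; rewrite -(ler_nat R) !natrD.
  move: (\sum_(b in B) _)%N sQ sF (_ * _)%N (N * _) exN sQ4 sF4 {sumQ sumF NeT Ne0}.
  move=> sB sQ sF c Ne exN sQ4 sF4 sumB; lra.
have KF : K \notin F.
  by apply/negP => KF; move: (avoidK K); rewrite inE KF !subxx => /(_ isT).
have avoidQ (S : {set {set V}}) : S \subset K.2 -> S \notin Q.
  move=> SK; apply/negP => SQ.
  have SB : ((cover S, S) : subgraph_type V) \in B.
    by rewrite inE; apply/orP; right; apply/imsetP; exists S.
  move/negP: (avoidK _ SB); apply; rewrite SK andbT.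
  apply/bigcupsP => e /(subsetP SK); exact: (copy_edges_sub KH).2.
(* Adding [K] raises only the degrees of sets inside [K.2], by one, and none of these is
   saturated. *)
have balKF : balanced (K |: F).
  rewrite /balanced subUset sub1set KH FH; apply/forallP => S.
  apply/implyP => SG; apply/implyP => Sl.
  have [SK|nSK] := boolP (S \subset K.2).
    move: (avoidQ S SK); rewrite inE SG Sl /= -leNgt; apply: le_trans.
    rewrite ler_nat -add1n -(cards1 K).
    apply: leq_trans (leq_card_setU _ _); apply/subset_leq_card/subsetP => A.
    by rewrite !inE => /andP[/orP[->//|->] ->]; rewrite orbT.
  move/implyP: (degF S) => /(_ SG) /implyP /(_ Sl); apply: le_trans.
  rewrite ler_nat; apply/subset_leq_card/subsetP => A.
  by rewrite !inE => /andP[/predU1P[->|->//]]; rewrite (negPf nSK).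
by move: (maxF _ balKF); rewrite /= cardsU1 KF add1n ltnn.
Qed.

(** * Sample size and real exponents *)

Lemma powR_le_cancel (R : realType) (d a b : R) :
  0 < d -> 0 <= a -> 0 <= b -> a `^ d <= b `^ d -> a <= b.
Proof.
move=> d0 a0 b0; apply: contraTT; rewrite -!ltNge => ba.
by apply: gt0_ltr_powR; rewrite ?nnegrE.
Qed.

(** Write [q ^+ i] as [q ^ d] raised to [i / d]; since [g <= 1], lowering the exponent to [s] can
    only increase the power of [g]. *)
Lemma expr_le_powR (R : realType) (q g d s : R) (i : nat) :
  0 <= q -> 0 < d -> 0 < g <= 1 -> q `^ d <= g -> s <= i%:R / d ->
  q ^+ i <= g `^ s.
Proof.
move=> q0 d0 g01 qg si; have /andP[g0 _] := g01.
rewrite -powR_mulrn //.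
have -> : q `^ i%:R = (q `^ d) `^ (i%:R / d).
  by rewrite -powRrM mulrC divfK ?gt_eqF.
apply: (@le_trans _ _ (g `^ (i%:R / d))); last exact: ger_powR.
by apply: ge0_ler_powR; rewrite ?nnegrE ?powR_ge0 ?divr_ge0 // ltW.
Qed.

Lemma sample_size (R : realType) (d B k : R) (r n : nat) :
  0 < d -> (0 < r)%N -> r%:R `^ d <= B -> 2 `^ d * B <= k -> k <= n%:R `^ d ->
  exists m : nat, [/\ (r <= m)%N, (m <= n)%N, B * n%:R `^ d <= k * m%:R `^ d
    & k * m%:R `^ d <= 2 `^ d * B * n%:R `^ d].
Proof.
move=> d0 r0 rB Bk kn.
have B0 : 0 < B by apply: lt_le_trans rB; rewrite powR_gt0 ?ltr0n.
have k0 : 0 < k by apply: lt_le_trans Bk; rewrite mulr_gt0 ?powR_gt0.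
(* The exact solution of [k x^d = B n^d]. The bounds on [k] give [r <= x] and [2 x <= n]; as
   [x >= 1], the integer [truncn x + 1] lies between [x] and [2 x], which costs the factor [2^d]. *)
pose x := (B / k) `^ d^-1 * n%:R.
have x0 : 0 <= x by rewrite mulr_ge0 ?powR_ge0.
have xd : k * x `^ d = B * n%:R `^ d.
  rewrite powRM ?powR_ge0 // -powRrM mulVf ?gt_eqF // powRr1 ?divr_ge0 ?ltW //.
  by rewrite mulrA mulrCA divff ?mulr1 ?gt_eqF.
have rx : r%:R <= x.
  apply: (powR_le_cancel d0) => //; rewrite -(ler_pM2l k0) xd mulrC.
  by apply: ler_pM => //; rewrite ?powR_ge0 ?ltW.
have x2d : k * (2 * x) `^ d = 2 `^ d * B * n%:R `^ d.
  by rewrite powRM // mulrCA xd mulrA.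
have xn : 2 * x <= n%:R.
  apply: (powR_le_cancel d0); rewrite ?(mulr_ge0 _ x0) //.
  by rewrite -(ler_pM2l k0) x2d ler_wpM2r ?powR_ge0.
have mx := truncnS_gt x.
have mx2 : (Num.truncn x).+1%:R <= 2 * x.
  have := truncn_le x; rewrite x0 -natr1.
  have : (1 : R) <= r%:R by rewrite ler1n.
  lra.
exists (Num.truncn x).+1; split.
- by rewrite -(ler_nat R) (le_trans rx) ?ltW.
- by rewrite -(ler_nat R) (le_trans mx2).
- by rewrite -xd ler_wpM2l ?(ltW k0) // ge0_ler_powR ?nnegrE // ltW.
- by rewrite -x2d ler_wpM2l ?(ltW k0) // ge0_ler_powR ?nnegrE ?(mulr_ge0 _ x0) // ltW.
Qed.

(** The bound on [m] says [m / n <= (M / k)^(1/d)]. It is applied with [s = lam (|S| - 1)] to covers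
    of edge sets and with [s = (h - r) / d] to vertex sets of copies. *)
Lemma card_supersets_le_powR (R : realType) (V : finType) (m r : nat)
    (W : {set V}) (d M k s : R) :
  (0 < #|V|)%N -> (m <= #|V|)%N -> (r <= #|W|)%N ->
  0 < d -> 0 < M <= k -> k * m%:R `^ d <= M * #|V|%:R `^ d ->
  s <= (#|W|%:R - r%:R) / d ->
  #|supersets m W|%:R <= 'C(#|V| - r, m - r)%:R * (M / k) `^ s.
Proof.
move=> V0 mV rW d0 /andP[M0 Mk] mM sW.
have k0 : 0 < k by apply: lt_le_trans Mk.
have VR0 : 0 < #|V|%:R :> R by rewrite ltr0n.
have := card_supersets_le rW mV.
rewrite -(ler_nat R) !natrM !natrX -ler_pdivlMr ?exprn_gt0 //.
move=> /le_trans; apply; rewrite -mulrA ler_wpM2l // -expr_div_n.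
apply: (@expr_le_powR _ _ _ d); rewrite ?divr_ge0 //.
- by rewrite divr_gt0 //= ler_pdivrMr ?mul1r.
- rewrite ler_pdivlMr // powRM ?invr_ge0 // -[_^-1]powR_inv1 // -powRrM mulN1r powRN.
  by rewrite mulrAC ler_pdivrMr ?powR_gt0 // mulrC.
- by rewrite natrB.
Qed.

Lemma card_r_graph_le (V : finType) (r : nat) (G : {set {set V}}) :
  r_graph r G -> (#|G| <= #|V| ^ r)%N.
Proof.
move=> /forall_inP Gr.
apply: (@leq_trans 'C(#|V|, r)).
  rewrite -card_draws; apply/subset_leq_card/subsetP => e /Gr er.
  by rewrite inE.
apply: (@leq_trans (#|V| ^_ r)).
  by rewrite -bin_ffact leq_pmulr ?fact_gt0.
elim: r {Gr} => [|i IH]; first by rewrite ffactn0.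
by rewrite ffactnSr expnSr leq_mul // leq_subr.
Qed.

Lemma dense_r_graph_le (R : realType) (V : finType) (r : nat)
    (G : {set {set V}}) (alpha k : R) :
  (0 < #|V|)%N -> r_graph r G -> #|G|%:R = k * #|V|%:R `^ alpha ->
  k <= #|V|%:R `^ (r%:R - alpha).
Proof.
move=> V0 Gr Gk.
have VR0 : 0 < #|V|%:R :> R by rewrite ltr0n.
rewrite powRB ?(gt_eqF VR0) ?implybT // ler_pdivlMr ?powR_gt0 // -Gk.
by rewrite powR_mulrn // -natrX ler_nat card_r_graph_le.
Qed.

(** * Choice of constants and verification *)

Theorem theorem3p5 (R : realType) (r h l : nat) (VH : finType)
    (H : {set {set VH}}) (alpha A : R)
    (r_ge2 : (2 <= r)%N)
    (H_rgraph : r_graph r H) (H_rpartite : r_partite r H)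
    (H_vertices : #|VH| = h) (H_edges : #|H| = l) (l_ge2 : (2 <= l)%N)
    (alpha_gt0 : 0 < alpha) (A_gt0 : 0 < A)
    (A_ge : (r ^ (2 * r))%:R <= A)
    (alpha_gt : r%:R - 1 / r_density R r H < alpha)
    (ex_le : forall n : nat, (ex r n H)%:R <= A * n%:R `^ alpha) :
  exists delta k0 C : R,
    [/\ 0 < delta, 0 < k0, 0 < C &
      forall (n : nat) (V : finType) (G : {set {set V}}) (k : R),
        (0 < n)%N -> #|V| = n -> r_graph r G ->
        #|G|%:R = k * n%:R `^ alpha -> k0 <= k ->
        exists F : {set subgraph_type V},
          [/\ F \subset copies H G,
              delta * #|G|%:R `^ ((h%:R - alpha) / (r%:R - alpha))
                / n%:R `^ (alpha * (h%:R - r%:R) / (r%:R - alpha))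
                <= #|F|%:R
            & forall S : {set {set V}},
                S \subset G -> (1 <= #|S| <= l)%N ->
                (degree F S)%:R
                  <= C * k `^ (- lambda r alpha H * (#|S|%:R - 1))
                       * (#|F|%:R / #|G|%:R)]].
Proof.
have l0 : (0 < l)%N by exact: leq_trans l_ge2.
have H0 : H != set0 by rewrite -card_gt0 H_edges.
have [r_le_alpha|alpha_lt_r] := leP r%:R alpha.
  (* Here k n^alpha <= n^r forces k <= 1. *)
  exists 1, 2, 1; split=> // n V G k n0 cV Gr Gk k2.
  rewrite -cV in n0 Gk.
  have := dense_r_graph_le n0 Gr Gk.
  rewrite -(opprB alpha) powRN => /(le_trans k2).
  have : 1 <= #|V|%:R `^ (alpha - r%:R).
    by rewrite -[leLHS](powRr0 #|V|%:R) ler_powR ?ler1n // subr_ge0.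
  move=> p1 /le_trans - /(_ 1); rewrite invf_le1 ?(lt_le_trans _ p1) // p1.
  by move=> /(_ isT); lra.
set d := r%:R - alpha; have d0 : 0 < d by rewrite subr_gt0.
set mr := r_density R r H in alpha_gt.
have dens (VK : finType) (G S : {set {set VK}}) K : K \in copies H G -> S \subset K.2 ->
    S != set0 -> #|S|%:R - 1 <= mr * (#|cover S|%:R - r%:R).
  by move=> KH SK S0; apply: copy_edges_le_density KH SK S0.
have densH : l%:R - 1 <= mr * (#|cover H|%:R - r%:R).
  by rewrite -H_edges; apply: edges_le_density.
have rcov : r%:R <= #|cover H|%:R :> R by rewrite ler_nat card_cover_ge.
have covh : #|cover H|%:R <= h%:R :> R by rewrite ler_nat -H_vertices max_card.
have l1 : 1 <= l%:R - 1 :> R.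
  by have : 2%:R <= l%:R :> R; [rewrite ler_nat|lra].
(* Since [l >= 2], [densH] has a left side of at least 1, while [#|cover H| - r] is nonnegative. *)
have mr0 : 0 < mr.
  rewrite ltNge; apply/negP => mr_le0.
  have : mr * (#|cover H|%:R - r%:R) <= 0 by rewrite mulr_le0_ge0 // subr_ge0.
  lra.
have rh : 0 <= h%:R - r%:R :> R by lra.
set lam := lambda r alpha H.
have lamE x : lam * x = x / mr / d.
  by rewrite /lam /lambda -/mr -/d div1r invfM mulrC mulrA.
have lam0 : 0 < lam by rewrite /lam /lambda divr_gt0 // mulr_gt0.
set sH := (h%:R - r%:R) / d; have sH0 : 0 <= sH by rewrite divr_ge0 // ltW.
have lam_le j : (j <= l)%N -> lam * (j%:R - 1) <= sH.
  move=> jl; rewrite lamE ler_pM2r ?invr_gt0 // ler_pdivrMr // mulrC.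
  have jlR : j%:R <= l%:R :> R by rewrite ler_nat.
  have : mr * (#|cover H|%:R - r%:R) <= mr * (h%:R - r%:R).
    by rewrite ler_wpM2l ?(ltW mr0) // lerB.
  lra.
(* [r^r] pays for [bin_le_sub] and [A] for the bound on [ex]. The 4 is the factor 2 wanted in
   [balanced_family], doubled to make the inequality strict. *)
pose B : R := 4 * A * r%:R ^+ r.
pose M : R := 2 `^ d * B.
have r0 : (0 < r)%N by exact: leq_trans r_ge2.
have rR1 : 1 <= r%:R :> R by rewrite ler1n.
have A1 : 1 <= A by apply: le_trans A_ge; rewrite ler1n expn_gt0 r0.
have rr1 : 1 <= r%:R ^+ r :> R by exact: exprn_ege1.
have rB : r%:R `^ d <= B.
  apply: (@le_trans _ _ (r%:R `^ r%:R)).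
    by rewrite ler_powR // /d lerBlDr lerDl ltW.
  by rewrite powR_mulrn // ler_peMl //; lra.
have B1 : 1 <= B by rewrite /B -[leLHS]mulr1 ler_pM //; lra.
have M1 : 1 <= M.
  rewrite /M -[leLHS]mulr1 ler_pM // -[leLHS](powRr0 2) ler_powR ?(ltW d0) //.
  by rewrite ler1n.
have M0 : 0 < M by lra.
(* Chosen so that [N (M / k)^sH * 4 T] is exactly [N * #|G|], the bound required for copies. *)
pose delta : R := (M `^ sH)^-1 / 4.
have Ms0 : 0 < M `^ sH by exact: powR_gt0.
have delta0 : 0 < delta by rewrite divr_gt0 ?invr_gt0.
pose D : R := M `^ (lam * l%:R).
have D0 : 0 < D by exact: powR_gt0.
(* The first summand serves the bound on edge sets, [D] dominating every [M^(lam (|S| - 1))]; the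
   second gives [C * delta >= 2], hence [Delta >= 2]. *)
pose C : R := (2 ^ (l + 3))%:R * D + 2 / delta.
have CD : (2 ^ (l + 3))%:R * D <= C by rewrite lerDl divr_ge0 // ltW.
have Cdelta : 2 <= C * delta.
  by rewrite -ler_pdivrMr // /C lerDr mulr_ge0 // ltW.
have C0 : 0 < C by rewrite -(pmulr_lgt0 _ delta0); lra.
exists delta, M, C; split=> // n V G k n0 cV Gr Gk Mk.
have k0 : 0 < k by lra.
have k1 : 1 <= k by lra.
rewrite -cV in n0 Gk *.
have VR0 : 0 < #|V|%:R :> R by rewrite ltr0n.
have Va0 : 0 < #|V|%:R `^ alpha :> R by exact: powR_gt0.
have G0 : 0 < #|G|%:R :> R by rewrite Gk mulr_gt0.
pose T : R := delta * k `^ sH * #|G|%:R.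
have T0 : 0 < T by rewrite mulr_gt0 // mulr_gt0 ?powR_gt0.
(* The exponent of [#|G|] is [sH + 1]; substituting [k n^alpha] in the factor with exponent [sH]
   cancels the power of [n]. *)
have TE : delta * #|G|%:R `^ ((h%:R - alpha) / d)
    / #|V|%:R `^ (alpha * (h%:R - r%:R) / d) = T.
  have -> : (h%:R - alpha) / d = sH + 1.
    have -> : h%:R - alpha = (h%:R - r%:R) + d by rewrite /d; ring.
    by rewrite mulrDl mulfV ?gt_eqF.
  have -> : alpha * (h%:R - r%:R) / d = alpha * sH by rewrite /sH mulrA.
  have VaH : #|V|%:R `^ (alpha * sH) != 0 by rewrite gt_eqF ?powR_gt0.
  rewrite powRD ?(gt_eqF G0) ?implybT // powRr1 ?ltW // /T.
  rewrite {1}Gk powRM ?ltW // -powRrM -mulrA [k `^ _ * _ * _]mulrAC mulfK //.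
  by rewrite mulrA.
pose Delta j := C * k `^ (- lam * (j%:R - 1)) * (T / #|G|%:R).
(* By [lam_le], the factor [k^sH] in [T] outweighs [k^(- lam (j - 1))], because [k >= 1]. *)
have Delta2 j : (1 <= j <= #|H|)%N -> 2 <= Delta j.
  rewrite H_edges => /andP[_ jl]; apply: (le_trans Cdelta).
  rewrite /Delta /T mulfK ?gt_eqF // -mulrA ler_pM2l // mulrCA ler_peMr ?(ltW delta0) //.
  rewrite -powRD ?(gt_eqF k0) ?implybT // -[leLHS](powRr0 k) ler_powR // mulNr addrC subr_ge0.
  exact: lam_le.
have [m [rm mn mlow mup]] :=
  sample_size d0 r0 rB Mk (dense_r_graph_le n0 Gr Gk).
have m0 : (0 < m)%N by exact: leq_trans rm.
have MkP : 0 < M <= k by rewrite M0.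
have Mkpow s : (M / k) `^ s = M `^ s / k `^ s.
  by rewrite powRM ?invr_ge0 ?ltW // -[k^-1]powR_inv1 ?ltW // -powRrM mulN1r powRN.
have [|||F [FH TF Fdeg]] := @balanced_family R VH V H G r m Delta T Gr rm H0 T0 Delta2.
- move=> K KH S SK S0.
  have [KG _] := copy_edges_sub KH.
  have Sr := r_graph_sub (subset_trans SK KG) Gr.
  have Sl : (#|S| <= l)%N by rewrite -H_edges -(card_copy KH).2 subset_leq_card.
  have rS := card_cover_ge Sr S0.
  have := @card_supersets_le_powR R V m r (cover S) d M k (lam * (#|S|%:R - 1))
    n0 mn rS d0 MkP mup.
  rewrite lamE ler_pM2r ?invr_gt0 // ler_pdivrMr // mulrC (dens _ _ _ _ KH SK S0) -lamE.
  move=> /(_ isT) supS.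
  rewrite -mulrA; apply: le_trans (ler_wpM2r _ supS) _.
    by rewrite mulr_ge0 // ltW.
  rewrite -[leLHS]mulrA -[leRHS]mulrA ler_wpM2l //.
  have MD : M `^ (lam * (#|S|%:R - 1)) <= D.
    rewrite ler_powR // ler_pM2l // (le_trans _ (_ : #|S|%:R <= _)) ?ler_nat //.
    by rewrite lerBlDr lerDl.
  rewrite /Delta Mkpow mulNr powRN.
  have -> : #|G|%:R * (C * (k `^ (lam * (#|S|%:R - 1)))^-1 * (T / #|G|%:R))
     = C * (k `^ (lam * (#|S|%:R - 1)))^-1 * T.
    by field; rewrite !gt_eqF ?powR_gt0.
  rewrite [leLHS]mulrA ler_pM2r // mulrAC ler_pM2r ?invr_gt0 ?powR_gt0 //.
  by rewrite mulrC H_edges; apply: le_trans CD; rewrite ler_wpM2l.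
- move=> K KH.
  have cK : #|K.1| = h by rewrite (card_copy KH).1.
  have := @card_supersets_le_powR R V m r K.1 d M k sH n0 mn _ d0 MkP mup.
  rewrite cK lexx -(ler_nat R) -subr_ge0 => /(_ rh isT) supK.
  rewrite -mulrA; apply: le_trans (ler_wpM2r _ supK) _.
    by rewrite mulr_ge0 // ltW.
  rewrite -mulrA ler_wpM2l // Mkpow /T /delta.
  rewrite [leLHS](_ : _ = #|G|%:R) //.
  by field; rewrite !gt_eqF ?powR_gt0.
- have mR0 : 0 < m%:R :> R by rewrite ltr0n.
  have exm := ex_le m.
  have binle : 'C(#|V|, m)%:R * m%:R ^+ r
      <= r%:R ^+ r * #|V|%:R ^+ r * 'C(#|V| - r, m - r)%:R :> R.
    by rewrite -!natrX -!natrM ler_nat bin_le_sub ?rm.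
  have pow_split x : 0 < x -> x ^+ r = x `^ d * x `^ alpha.
    move=> x0; rewrite -powRD ?(gt_eqF x0) ?implybT // /d subrK.
    by rewrite powR_mulrn // ltW.
  rewrite (pow_split _ mR0) (pow_split _ VR0) in binle.
  have rr0 : 0 < r%:R ^+ r :> R by lra.
  have binV : 0 < 'C(#|V|, m)%:R :> R by rewrite ltr0n bin_gt0.
  have Vd0 : 0 < #|V|%:R `^ d :> R by exact: powR_gt0.
  have ma0 : 0 < m%:R `^ alpha :> R by exact: powR_gt0.
  (* After scaling by [r^r n^d], the chain is [B C(n,m) m^alpha n^d <= k C(n,m) m^r <= k r^r n^r N],
     with [n^r = n^d n^alpha]. Once the powers are abstracted, [lra] treats the monomials as
     atoms. *)
  rewrite Gk natrM -(ltr_pM2l (mulr_gt0 rr0 Vd0)).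
  have low := ler_wpM2l (ltW (mulr_gt0 binV ma0)) mlow.
  have up := ler_wpM2l (ltW k0) binle.
  have exC := ler_wpM2l (ltW (mulr_gt0 (mulr_gt0 rr0 Vd0) binV)) exm.
  have pos := mulr_gt0 (mulr_gt0 (mulr_gt0 rr0 Vd0) binV) (mulr_gt0 A_gt0 ma0).
  rewrite /B in low.
  move: low up exC pos.
  move: (r%:R ^+ r) (#|V|%:R `^ d) ('C(#|V|, m)%:R) (m%:R `^ alpha) (m%:R `^ d).
  move: (#|V|%:R `^ alpha) ('C(_, _)%:R) (ex r m H)%:R.
  move=> y N e P x c w u; lra.
exists F; split=> //; first by rewrite TE.
move=> S SG; rewrite -H_edges => Sl; apply: le_trans (Fdeg S SG Sl) _.
(* [Delta] was built with [T]; since [T <= #|F|], replacing it by [#|F|] only weakens the bound. *)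
by rewrite /Delta ler_pM2l ?mulr_gt0 ?powR_gt0 // ler_pM2r ?invr_gt0.
Qed.
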